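(* Let $p$ be an odd prime, $q$ a power of $p$, $k$ an integer with $0\le k\le p-1$, and $n\ge 0$ an integer. Let $V=\{y\in\mathbb{F}_{q^2}: y^q=1-y\}$ and $S=(\mathbb{F}_q\cup V)\setminus\{\tfrac12\}\subseteq\mathbb{F}_{q^2}$. For $y\in\mathbb{F}_{q^2}\setminus\{\tfrac12\}$ put $$g(y)=k\,\frac{y^n(1-y)-y(1-y)^n}{2y-1}+y^n+(1-y)^n.$$ Then $D_{n,k}(1,x)$ is a permutation polynomial of $\mathbb{F}_q$ if and only if $g$ is a 2-to-1 mapping on $S$ and $g(y)\neq\frac{k(n-1)+2}{2^n}$ for every $y\in S$.
   Context: For an integer $n\ge1$, $D_{n,k}(1,x)=\sum_{i=0}^{\lfloor n/2\rfloor}\frac{n-ki}{n-i}\binom{n-i}{i}(-x)^i\in\mathbb{F}_q[x]$ (the coefficients are integers, reduced mod $p$), and $D_{0,k}(1,x)=2-k$. A permutation polynomial of $\mathbb{F}_q$ is a polynomial inducing a bijection of $\mathbb{F}_q$. Note $g(y)=g(1-y)$ and $S$ is stable under $y\mapsto 1-y$ with no fixed points; ''$g$ is a 2-to-1 mapping on $S$'' means that for $y_1,y_2\in S$, $g(y_1)=g(y_2)$ holds if and only if $y_2\in\{y_1,1-y_1\}$. *)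

(* Defs.v *)
From HB Require Import structures.
From mathcomp Require Import all_boot all_order all_algebra.

Set Implicit Arguments.
Unset Strict Implicit.
Unset Printing Implicit Defensive.

Import Order.TTheory GRing.Theory Num.Theory.

Local Open Scope ring_scope.

(* The integer division is exact for i <= n/2 and n > 0: see rdickson_coefE. *)
Definition rdickson_coef (n k i : nat) : int :=
  (((n%:Z - k%:Z * i%:Z) * ('C(n - i, i)%N)%:Z) %/ (n - i)%N%:Z)%Z.

Lemma rdickson_coefE (n k i : nat) : (0 < n)%N -> (i <= n./2)%N ->
  (rdickson_coef n k i)%:~R =
  (n%:R - k%:R * i%:R) / (n%:R - i%:R) * ('C(n - i, i)%N)%:R :> rat.
Proof.
move=> n_gt0 le_i_n2.
have lt_in : (i < n)%N.
  apply: leq_ltn_trans le_i_n2 _.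
  by rewrite -{2}[n]odd_double_half -addnn; case: n n_gt0 => [|[|n]] //= _;
     rewrite addnA -[X in (X < _)%N]add0n ltn_add2r addn_gt0 /= orbT.
have ni_gt0 : (0 < n - i)%N by rewrite subn_gt0.
have dvd_ni : (n - i %| i * 'C(n - i, i))%N.
  case: i lt_in {le_i_n2} ni_gt0 => [|i] lt_in ni_gt0; first by rewrite mul0n dvdn0.
  by case: (n - i.+1)%N ni_gt0 => // m _; rewrite -mul_bin_diag dvdn_mulr.
have dvd_num :
    ((n - i)%N%:Z %| (n%:Z - k%:Z * i%:Z) * ('C(n - i, i)%N)%:Z)%Z.
  have -> : n%:Z - k%:Z * i%:Z = (n - i)%N%:Z + (1 - k%:Z) * i%:Z.
    by rewrite -subzn 1?ltnW // mulrBl mul1r addrA subrK.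
  by rewrite mulrDl; apply: rpredD; [exact: dvdz_mulr | rewrite -mulrA dvdz_mull].
have ni_neq0 : (n - i)%N%:R != 0 :> rat by rewrite pnatr_eq0 -lt0n.
rewrite -natrB 1?ltnW // mulrAC; apply: (mulIf ni_neq0); rewrite divfK //.
have := congr1 (fun z : int => z%:~R : rat) (divzK dvd_num).
by rewrite /= !rmorphM rmorphB /= rmorphM /= !pmulrn.
Qed.

(* Reversed Dickson polynomial of the (k+1)-th kind D_{n,k}(1, x). *)
Definition rdickson (R : nzRingType) (n k : nat) : {poly R} :=
  if n == 0%N then (2 - k%:R)%:P
  else \sum_(i < n./2.+1) (rdickson_coef n k i)%:~R *: (- 'X) ^+ i.

Definition perm_poly (F : finFieldType) (f : {poly F}) : Prop :=
  bijective (fun x : F => f.[x]).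

Section QuadraticExtension.

(* F is F_q, and iota is the inclusion of F_q in L = F_{q^2}. *)
Variables (F L : finFieldType) (iota : {rmorphism F -> L}).

Definition Vset : {set L} := [set y | y ^+ #|F| == 1 - y].

Definition Sset : {set L} := ((iota @: [set: F]) :|: Vset) :\ 2^-1.

End QuadraticExtension.

(* Meant for y != 1/2; at y = 1/2 the quotient takes the junk value 0. *)
Definition gfun (L : fieldType) (n k : nat) (y : L) : L :=
  k%:R * ((y ^+ n * (1 - y) - y * (1 - y) ^+ n) / (2 * y - 1))
  + y ^+ n + (1 - y) ^+ n.

Definition two_to_one_on (L : finFieldType) (S : {set L}) (g : L -> L) : Prop :=
  forall y1 y2, y1 \in S -> y2 \in S ->
    (g y1 = g y2 <-> y2 = y1 \/ y2 = 1 - y1).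

(* Main.v *)
(* D_{n,k}(1, x) satisfies D_{n+2} = D_{n+1} - x D_n, whence
   D_{n,k}(1, y(1 - y)) = g(y) for y <> 1/2, while its value at
   1/4 = 1/2 (1 - 1/2) is (k(n - 1) + 2) / 2^n.  The map y |-> y(1 - y) sends S
   onto F_q \ {1/4} with fibres {y, 1 - y}: the discriminant 1 - 4x of
   y^2 - y + x is a square in F_{q^2}, and a root y has y^q equal to one of the
   two roots y, 1 - y.  So g being 2-to-1 on S means that D_{n,k}(1, x) is
   injective off 1/4, and the second condition that its value at 1/4 is not
   taken elsewhere. *)
Require Import Defs.
From HB Require Import structures.
From mathcomp Require Import all_boot all_order all_algebra.
From mathcomp Require Import cyclic finfield.
From mathcomp Require Import ring.

Set Implicit Arguments.
Unset Strict Implicit.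
Unset Printing Implicit Defensive.

Import Order.TTheory GRing.Theory Num.Theory.

Local Open Scope ring_scope.

Lemma nat_ind2 (P : nat -> Prop) :
  P 0 -> P 1 -> (forall n, P n -> P n.+1 -> P n.+2) -> forall n, P n.
Proof.
move=> P0 P1 PS n; suff: P n /\ P n.+1 by case.
by elim: n => // n [? ?]; split=> //; apply: PS.
Qed.

(** * Diagonal binomial sums *)

Section BinomialSum.

Variable R : comNzRingType.

(** At [t = -x] this is the reversed Dickson polynomial with [k = 1]. Summing up to [n] instead of
    [n./2] adds only zero binomials and lets Pascal's rule apply without parity cases. *)
Definition binomial_sum (n : nat) (t : R) : R :=
  \sum_(i < n.+1) 'C(n - i, i)%:R * t ^+ i.

Lemma binomial_sumSS n t :
  binomial_sum n.+2 t = binomial_sum n.+1 t + t * binomial_sum n t.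
Proof.
rewrite /binomial_sum big_ord_recr /= subnn mul0r addr0.
rewrite 2!(big_ord_recl n.+1) /= !subn0 !bin0 -addrA; congr (_ + _).
rewrite mulr_sumr -big_split; apply: eq_bigr => i _ /=.
rewrite /bump /= !add1n !subSS subSn ?leq_ord // binS natrD exprS.
by rewrite mulrDl; congr (_ + _); rewrite mulrCA.
Qed.

Lemma binomial_sum_half n t :
  binomial_sum n t = \sum_(i < n./2.+1) 'C(n - i, i)%:R * t ^+ i.
Proof.
have le_half : (n./2.+1 <= n.+1)%N by rewrite ltnS -divn2 leq_div.
rewrite [RHS](big_ord_widen n.+1 (fun i => 'C(n - i, i)%:R * t ^+ i)) //.
rewrite /binomial_sum (bigID (fun i : 'I_n.+1 => (i < n./2.+1)%N)) /=.
rewrite [X in _ + X]big1 ?addr0 // => i; rewrite -leqNgt => lt_i.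
rewrite bin_small ?mul0r // ltn_subLR ?leq_ord // addnn.
by rewrite -ltn_half_double.
Qed.

End BinomialSum.

(* With [N = n + 2] and [I = i + 1]: [N - k I = (N - I) + (1 - k) I], and
   [I / (N - I) * 'C(N - I, I) = 'C(N - I - 1, I - 1)]. *)
Lemma rdickson_coefS n k i : (i.+1 <= n.+2./2)%N ->
  rdickson_coef n.+2 k i.+1 =
  'C(n.+2 - i.+1, i.+1)%:Z + (1 - k%:Z) * 'C(n - i, i)%:Z.
Proof.
rewrite /= ltnS => le_i; have {le_i} le_in : (i <= n)%N.
  by apply: leq_trans le_i _; rewrite -divn2 leq_div.
rewrite /rdickson_coef subSS subSn //.
set m := (n - i)%N; have -> : n = (m + i)%N by rewrite subnK.
have := congr1 Posz (mul_bin_diag m.+1 i); rewrite !PoszM /= => diag.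
rewrite -[RHS](@mulKz _ m.+1%:Z) //; congr (_ %/ _)%Z.
have -> : (m + i).+2%:Z = m.+1%:Z + i.+1%:Z :> int by rewrite -PoszD addnS.
rewrite mulrDr mulrCA diag; ring.
Qed.

(** * Recurrence and values of the reversed Dickson polynomials *)

Section ReversedDickson.

Variable R : comNzRingType.

Lemma rdickson0 k : rdickson R 0 k = (2 - k%:R)%:P.
Proof. by []. Qed.

Lemma rdickson1 k : rdickson R 1 k = 1.
Proof.
by rewrite /rdickson /= big_ord1 expr0 /rdickson_coef !mulr0 subr0 scale1r.
Qed.

(** The index shift in [rdickson_coefS] produces the factor [- 'X]. The recurrence for [rdickson]
    thus reduces to that of [binomial_sum]. *)
Lemma rdickson_binomial_sum n k :
  rdickson R n.+2 k = binomial_sum n.+2 (- 'X)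
                      - (1 - k%:R) * 'X * binomial_sum n (- 'X).
Proof.
rewrite !binomial_sum_half /rdickson /= !(big_ord_recl n./2.+1) /= -addrA.
congr (_ + _).
  rewrite /rdickson_coef !subn0 !bin0 !expr0 mulr0 subr0 mulr1 divzz /=.
  by rewrite scale1r mulr1.
rewrite mulr_sumr -sumrB; apply: eq_bigr => i _.
rewrite /bump !add1n rdickson_coefS ?ltnS ?leq_ord // -mul_polyC.
rewrite rmorphD rmorphM rmorphB /= exprS.
rewrite polyCD polyCM polyCB !polyC_natr; ring.
Qed.

Lemma rdicksonSS n k :
  rdickson R n.+2 k = rdickson R n.+1 k - 'X * rdickson R n k.
Proof.
have b0 : binomial_sum 0 (- 'X : {poly R}) = 1.
  by rewrite /binomial_sum big_ord1 expr0 mulr1.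
have b1 : binomial_sum 1 (- 'X : {poly R}) = 1.
  by rewrite /binomial_sum big_ord_recr big_ord1 /= mul0r addr0 mulr1.
have PE : (2 - k%:R : R)%:P = 2 - k%:R by rewrite rmorphB !rmorph_nat.
(* The binomial form starts at index 2, so [n = 0] and [n = 1] use the initial values. *)
case: n => [|[|n]].
- by rewrite rdickson_binomial_sum binomial_sumSS b0 b1 rdickson1 rdickson0 PE; ring.
- rewrite !rdickson_binomial_sum !binomial_sumSS b0 b1 rdickson1; ring.
- rewrite !rdickson_binomial_sum !(binomial_sumSS n.+2) !(binomial_sumSS n.+1).
  by rewrite !(binomial_sumSS n); ring.
Qed.

End ReversedDickson.

Lemma map_rdickson (R R' : comNzRingType) (f : {rmorphism R -> R'}) n k :
  map_poly f (rdickson R n k) = rdickson R' n k.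
Proof.
elim/nat_ind2: n => [||n IHn IHSn].
- by rewrite !rdickson0 map_polyC /= rmorphB !rmorph_nat.
- by rewrite !rdickson1 rmorph1.
- by rewrite !rdicksonSS rmorphB rmorphM /= map_polyX IHn IHSn.
Qed.

(** As [y] and [1 - y] have sum 1, their powers, hence also [gfun], obey the recurrence [rdicksonSS]
    at [y * (1 - y)]. *)
Lemma rdickson_gfun (K : fieldType) n k (y : K) : 2 * y - 1 != 0 ->
  (rdickson K n k).[y * (1 - y)] = gfun n k y.
Proof.
move=> y_neq; elim/nat_ind2: n => [||n IHn IHSn].
- by rewrite rdickson0 hornerC /gfun; field.
- by rewrite rdickson1 hornerC /gfun; field.
- rewrite rdicksonSS !hornerE IHn IHSn /gfun.
  by rewrite !exprS; field.
Qed.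

(** At the double root 1/2 the recurrence is solved by [(a * n + b) / 2 ^+ n]. The subtraction
    [n%:R - 1] is in the field, so [n = 0] gives [2 - k]. *)
Lemma rdickson_quarter (K : fieldType) n k : 2 != 0 :> K ->
  (rdickson K n k).[2^-1 * (1 - 2^-1)] = (k%:R * (n%:R - 1) + 2) / 2 ^+ n.
Proof.
move=> two_neq0; elim/nat_ind2: n => [||n IHn IHSn].
- by rewrite rdickson0 hornerC expr0 divr1; ring.
- by rewrite rdickson1 hornerC expr1 subrr mulr0 add0r divff.
- rewrite rdicksonSS hornerD hornerN hornerM hornerX IHn IHSn !exprS; field.
  by rewrite expf_neq0 two_neq0.
Qed.

(** * Square roots and subfields in finite fields *)

Lemma finField_prim_root (L : finFieldType) :
  exists w : L, #|L|.-1.-primitive_root w.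
Proof.
have card_gt1 := card_finNzRing_gt1 L.
have card1_gt0 : (0 < #|L|.-1)%N by rewrite -subn1 subn_gt0.
suff /hasP[w _ w_prim] :
    has #|L|.-1.-primitive_root (enum (predC1 (0 : L))) by exists w.
apply: has_prim_root; rewrite ?enum_uniq -?cardE ?cardC1 //.
apply/allP=> x; rewrite mem_enum unity_rootE inE => x_neq0.
by apply/eqP/(mulfI x_neq0); rewrite mulr1 -exprS prednK ?expf_card // ltnW.
Qed.

(* For [w] of order [q^2 - 1], [z = w^i] is fixed by the [q]-power map only if
   [q + 1] divides [i], and [q + 1] is even. *)
Lemma finField_sqrt (L : finFieldType) (q : nat) (z : L) :
  odd q -> #|L| = (q ^ 2)%N -> z ^+ q = z -> exists s, s ^+ 2 = z.
Proof.
move=> q_odd cardL z_fix.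
have [-> | z_neq0] := eqVneq z 0; first by exists 0; rewrite expr0n.
have [w w_prim] := finField_prim_root L.
have q_gt0 : (0 < q)%N by case: (q) q_odd.
have cardL1 : #|L|.-1 = (q.-1 * q.+1)%N.
  by rewrite cardL -subn1 -[1%N](exp1n 2) subn_sqr subn1 addn1.
have z_unity : z ^+ q.-1 = 1.
  by apply: (mulfI z_neq0); rewrite mulr1 -exprS prednK.
have [|i z_def] := prim_rootP w_prim (x := z).
  by rewrite cardL1 exprM z_unity expr1n.
have q1_gt0 : (0 < q.-1)%N.
  have := prim_order_gt0 w_prim; rewrite cardL1 muln_gt0.
  by case/andP.
have : (q.+1 %| i)%N.
  rewrite -(dvdn_pmul2l q1_gt0) -cardL1 (prim_order_dvd w_prim) mulnC exprM.
  by rewrite -z_def z_unity.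
have q1_even : (2 %| q.+1)%N by rewrite dvdn2 /= q_odd.
move=> /(dvdn_trans q1_even)/dvdnP[j i_def].
by exists (w ^+ j); rewrite -exprM -i_def.
Qed.

Lemma rmorph_finField_image (F L : finFieldType) (iota : {rmorphism F -> L})
    (y : L) : (y \in iota @: [set: F]) = (y ^+ #|F| == y).
Proof.
apply/imsetP/eqP => [[x _ ->] | y_fix]; first by rewrite -rmorphXn expf_card.
(* ['X^q - 'X] is the product of the ['X - x] over [F]; at a fixed point [y] some factor of its
   image vanishes. *)
have := congr1 (fun p => (map_poly iota p).[y]) (finField_genPoly F).
rewrite /= rmorphB /= map_polyXn map_polyX !hornerE y_fix subrr rmorph_prod.
rewrite horner_prod => /esym/eqP/prodf_eq0[x _].
rewrite rmorphB /= map_polyX map_polyC !hornerE subr_eq0 => /eqP y_def.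
by exists x; rewrite ?inE.
Qed.

Lemma mul_onem_eq (K : fieldType) (y1 y2 : K) :
  (y1 * (1 - y1) == y2 * (1 - y2)) = (y2 == y1) || (y2 == 1 - y1).
Proof.
rewrite -subr_eq0 -[y2 == y1]subr_eq0 -[y2 == 1 - y1]subr_eq0 -mulf_eq0.
by congr (_ == 0); ring.
Qed.

(** * The parametrization of [F] by [y * (1 - y)] *)

Section QuadraticParametrization.

Variables (F L : finFieldType) (iota : {rmorphism F -> L}).
Hypotheses (two_neq0 : 2 != 0 :> L) (F_odd : odd #|F|).
Hypotheses (cardL : #|L| = (#|F| ^ 2)%N).
Hypothesis F_pchar : [pchar L].-nat #|F|.

(** The power map of exponent [#|F|] is additive, so it fixes [y * (1 - y)] exactly when it sends
    [y] to [y] or [1 - y]. *)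
Lemma mem_FV (y : L) :
  (y \in iota @: [set: F] :|: Vset F L) = (y * (1 - y) \in iota @: [set: F]).
Proof.
have onem_card : (1 - y) ^+ #|F| = 1 - y ^+ #|F|.
  by rewrite exprDn_pchar // exprNn_pchar // expr1n.
rewrite inE !rmorph_finField_image inE exprMn onem_card.
by rewrite [RHS]eq_sym mul_onem_eq.
Qed.

Lemma mem_SsetE (y : L) :
  (y \in Sset iota) = (y != 2^-1) && (y * (1 - y) \in iota @: [set: F]).
Proof. by rewrite in_setD1 mem_FV. Qed.

Lemma mul_onem_surj (x : F) : exists y : L, y * (1 - y) = iota x.
Proof.
have four_neq0 : 4 != 0 :> L by rewrite (natrM _ 2 2) mulf_neq0.
have [|s s_def] := @finField_sqrt L #|F| (iota (1 - 4 * x)) F_odd cardL.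
  by rewrite -rmorphXn expf_card.
(* A root of [y^2 - y + x], with [s] a square root of its discriminant. *)
exists ((1 + s) / 2).
have -> : iota x = (1 - s ^+ 2) / 4.
  by rewrite s_def rmorphB rmorphM rmorph1 rmorph_nat; field.
by field; rewrite four_neq0.
Qed.

(** The fibre [{y, 1 - y}] collapses to one point at 1/2. *)
Lemma mul_onem_half (y : L) : (y * (1 - y) == 2^-1 * (1 - 2^-1)) = (y == 2^-1).
Proof.
rewrite mul_onem_eq ![2^-1 == _]eq_sym; have [//|] := eqVneq y 2^-1.
by apply: contraNF => /eqP h; rewrite -[y](subKr 1) h; apply/eqP; field.
Qed.

End QuadraticParametrization.

Theorem theorem2p20 (p m q k n : nat) (F L : finFieldType)
    (iota : {rmorphism F -> L})
    (p_prime : prime p) (p_odd : odd p) (m_gt0 : (0 < m)%N)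
    (q_def : q = (p ^ m)%N) (cardF : #|F| = q) (cardL : #|L| = (q ^ 2)%N)
    (k_lt_p : (k <= p - 1)%N) :
  perm_poly (rdickson F n k) <->
  two_to_one_on (Sset iota) (gfun n k) /\
  (forall y : L, y \in Sset iota ->
     gfun n k y <> (k%:R * (n%:R - 1) + 2) / 2 ^+ n).
Proof.
have charL : p \in [pchar L].
  by apply: (rmorph_pchar iota); apply: (@card_finPcharP F p m); rewrite ?cardF.
have two_neq0 : 2 != 0 :> L.
  rewrite -(dvdn_pcharf charL) dvdn_prime2 //.
  by apply: contraL p_odd => /eqP->.
have F_odd : odd #|F| by rewrite cardF q_def oddX p_odd orbT.
have cardLF : #|L| = (#|F| ^ 2)%N by rewrite cardF.
have F_pchar : [pchar L].-nat #|F|.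
  by rewrite cardF q_def pnatX pnatE // charL.
(* [c] is 1/4, kept as a product to match [rdickson_quarter] and [mul_onem_half]. *)
pose f x := (rdickson F n k).[x]; pose c : F := 2^-1 * (1 - 2^-1).
have iota_f x : iota (f x) = (rdickson L n k).[iota x].
  by rewrite -(map_rdickson iota) horner_map.
have iota_c : iota c = 2^-1 * (1 - 2^-1).
  by rewrite rmorphM rmorphB rmorph1 fmorphV rmorph_nat.
have iota_fc : iota (f c) = (k%:R * (n%:R - 1) + 2) / 2 ^+ n.
  by rewrite iota_f iota_c rdickson_quarter.
have gE x y : y != 2^-1 -> y * (1 - y) = iota x -> gfun n k y = iota (f x).
  move=> y_neq y_x; rewrite iota_f -y_x rdickson_gfun // subr_eq0.
  apply: contra y_neq => /eqP y_half.
  by apply/eqP/(mulfI two_neq0); rewrite y_half mulfV.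
have S_param x : x != c -> exists2 y, y \in Sset iota & y * (1 - y) = iota x.
  move=> x_neq; have [y y_x] := mul_onem_surj iota two_neq0 F_odd cardLF x.
  exists y => //; rewrite mem_SsetE // y_x imset_f ?inE // andbT.
  by rewrite -mul_onem_half // y_x -iota_c fmorph_eq.
have S_elim y : y \in Sset iota ->
    exists x, [/\ x != c, y != 2^-1 & y * (1 - y) = iota x].
  rewrite mem_SsetE // => /andP[y_neq /imsetP[x _ y_x]]; exists x; split=> //.
  by rewrite -(inj_eq (fmorph_inj iota)) iota_c -y_x mul_onem_half.
split=> [/bij_inj f_inj | [g_inj g_neq]].
  split=> [y1 y2 /S_elim[x1 [_ y1_neq y1_x]] /S_elim[x2 [_ y2_neq y2_x]] | y].
    rewrite (gE x1) // (gE x2) //.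
    (* The 2-to-1 condition at [y1], [y2] becomes injectivity of [f] at the points below them. *)
    have -> : (y2 = y1 \/ y2 = 1 - y1) <-> x1 = x2.
      split=> [y12 | x12].
        apply: (fmorph_inj iota); rewrite -y1_x -y2_x; apply/eqP.
        by rewrite mul_onem_eq; case: y12 => ->; rewrite eqxx ?orbT.
      have: y1 * (1 - y1) == y2 * (1 - y2) by rewrite y1_x y2_x x12.
      by rewrite mul_onem_eq => /orP[]/eqP; [left | right].
    by split=> [/fmorph_inj/f_inj | ->].
  case/S_elim=> x [x_neq y_neq y_x]; rewrite (gE x) // -iota_fc.
  by move=> /fmorph_inj/f_inj x_c; rewrite x_c eqxx in x_neq.
apply: injF_bij => x1 x2 f12.
have {}f12 : iota (f x1) = iota (f x2) := congr1 iota f12.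
(* The second condition on [g] separates [c] from all other points. *)
have neq_c x : x != c -> iota (f x) <> iota (f c).
  case/S_param=> y yS y_x; have [x' [_ y_neq _]] := S_elim y yS.
  by rewrite -(gE x y) // iota_fc; apply: g_neq.
have [x1c | x1_neq] := eqVneq x1 c; have [x2c | x2_neq] := eqVneq x2 c.
- by rewrite x1c.
- by case: (neq_c x2 x2_neq); rewrite -f12 x1c.
- by case: (neq_c x1 x1_neq); rewrite f12 x2c.
(* Off [c], both points lift to [S], where the 2-to-1 condition puts the lifts in one fibre. *)
have [y1 y1S y1_x] := S_param x1 x1_neq.
have [y2 y2S y2_x] := S_param x2 x2_neq.
have [_ [_ y1_neq _]] := S_elim y1 y1S; have [_ [_ y2_neq _]] := S_elim y2 y2S.
have /(g_inj y1 y2 y1S y2S) y12 : gfun n k y1 = gfun n k y2.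
  by rewrite (gE x1) // (gE x2).
apply: (fmorph_inj iota); rewrite -y1_x -y2_x; apply/eqP.
by rewrite mul_onem_eq; case: y12 => ->; rewrite eqxx ?orbT.
Qed.
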